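(* Let $d=4$ and let $E$ be a general binary quartic (i.e. $E$ lies in a suitable dense Zariski-open subset of $\mathbb{P}^4$). Put $g_2=(\mathbb{F},\mathbb{F})_4$ and $g_3=(\mathbb{F},(\mathbb{F},\mathbb{F})_2)_4$, which are invariants of degrees $2$ and $3$ respectively. Then $\Omega_E\subseteq\mathbb{P}^4$ is a hypersurface of degree $6$, and its ideal $I_E\subseteq\mathbf{C}[a_0,\dots,a_4]$ is generated by $$\theta_E(g_3)^2\,g_2^3-\theta_E(g_2)^3\,g_3^2 .$$
   Context: The base field is $\mathbf{C}$. A nonzero binary form $E=\sum_{i=0}^d\binom{d}{i}\alpha_i x_1^{d-i}x_2^i$, taken up to scalar, is identified with the point $[\alpha_0,\dots,\alpha_d]\in\mathbb{P}^d=\mathrm{Proj}\,R$, $R=\mathbf{C}[a_0,\dots,a_d]$. $\mathbb{F}=\sum_{i=0}^d\binom{d}{i}a_i x_1^{d-i}x_2^i$ is the generic form. $SL_2$ acts on binary forms by linear substitutions in $x_1,x_2$, hence on $R$ and $\mathbb{P}^d$; $\Omega_E$ is the Zariski closure of the $SL_2$-orbit of $E$ in $\mathbb{P}^d$ and $I_E\subseteq R$ is its homogeneous defining ideal. For an invariant $g\in R$, $\theta_E(g)$ is the number obtained by substituting the coefficients $\alpha_i$ of $E$ for the $a_i$. For forms $A,B$ in $x_1,x_2$ of orders $p,q$ (possibly with coefficients in $R$), the $r$-th transvectant is $$(A,B)_r=\frac{(p-r)!\,(q-r)!}{p!\,q!}\sum_{i=0}^r(-1)^i\binom{r}{i}\frac{\partial^rA}{\partial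 x_1^{r-i}\partial x_2^i}\,\frac{\partial^rB}{\partial x_1^i\partial x_2^{r-i}}.$$ *)

(* Defs.v *)
From HB Require Import structures.
From mathcomp Require Import all_boot all_order all_algebra.
From mathcomp Require Import reals complex mpoly.

Set Implicit Arguments.
Unset Strict Implicit.
Unset Printing Implicit Defensive.

Import GRing.Theory.

Local Open Scope ring_scope.

(* Forms in x_1, x_2 with coefficients in S are elements of {mpoly S[2]};
   x_1 is 'X_ix1 and x_2 is 'X_ix2. *)
Definition ix1 : 'I_2 := ord0.
Definition ix2 : 'I_2 := ord_max.

Definition binary_form (S : comNzRingType) (d : nat) (c : 'I_d.+1 -> S) :
    {mpoly S[2]} :=
  \sum_(i < d.+1) ('C(d, i)%:R * c i) *: ('X_ix1 ^+ (d - i) * 'X_ix2 ^+ i).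

Definition generic_form (K : fieldType) (d : nat) :
    {mpoly {mpoly K[d.+1]}[2]} :=
  binary_form (fun i : 'I_d.+1 => 'X_i : {mpoly K[d.+1]}).

(* A and B are meant to be forms of orders p and q, with r <= p and r <= q. *)
Definition transvectant (K : fieldType) (n p q r : nat)
    (A B : {mpoly {mpoly K[n]}[2]}) : {mpoly {mpoly K[n]}[2]} :=
  (((p - r)`! * (q - r)`!)%:R / (p`! * q`!)%:R : K)%:MP *:
    \sum_(i < r.+1) ((-1) ^+ i * 'C(r, i)%:R) *:
      (A^`M(ix1, r - i)^`M(ix2, i) * B^`M(ix1, i)^`M(ix2, r - i)).

Lemma binary_form_homog (S : comNzRingType) d (c : 'I_d.+1 -> S) :
  binary_form c \is d.-homog.
Proof.
apply: rpred_sum => i _; apply: rpredZ.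
have X_homog j k : ('X_j : {mpoly S[2]}) ^+ k \is k.-homog.
  by rewrite -[X in X.-homog]mul1n dhomogMn // dhomogX /= mdeg1.
by have := dhomogM (X_homog ix1 (d - i)%N) (X_homog ix2 i); rewrite subnK // -ltnS.
Qed.

Lemma mderivm_homog (S : comNzRingType) n k j m (A : {mpoly S[n]}) :
  A \is (k + j).-homog -> mdeg m = j -> A^`M[m] \is k.-homog.
Proof.
move=> hA hm; apply/dhomogP => m'; rewrite mcoeff_msupp mcoeff_mderivm => h.
have hmm' : A@_(m + m') != 0 by apply: contraNneq h => ->; rewrite mul0rn.
rewrite -mcoeff_msupp in hmm'.
have /= := dhomog_mf hA hmm'; rewrite mdegD hm addnC => /eqP.
by rewrite eqn_add2r => /eqP.
Qed.

Lemma transvectant_homog (K : fieldType) n p q r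
    (A B : {mpoly {mpoly K[n]}[2]}) :
  (r <= p)%N -> (r <= q)%N -> A \is p.-homog -> B \is q.-homog ->
  transvectant p q r A B \is (p - r + (q - r)).-homog.
Proof.
move=> rp rq hA hB; apply/rpredZ/rpred_sum => i _; apply/rpredZ/dhomogM.
- have ir : (i <= r)%N by rewrite -ltnS.
  apply: (@mderivm_homog _ _ _ i); last by rewrite mdegMn mdeg1 mul1n.
  apply: (@mderivm_homog _ _ _ (r - i)); last by rewrite mdegMn mdeg1 mul1n.
  by rewrite -addnA subnKC // subnK.
have ir : (i <= r)%N by rewrite -ltnS.
apply: (@mderivm_homog _ _ _ (r - i)); last by rewrite mdegMn mdeg1 mul1n.
apply: (@mderivm_homog _ _ _ i); last by rewrite mdegMn mdeg1 mul1n.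
by rewrite -addnA subnK // subnK.
Qed.

Lemma homog0_const (S : comNzRingType) n (A : {mpoly S[n]}) :
  A \is 0.-homog -> A = (A@_0%MM)%:MP.
Proof.
move=> hA; apply/mpolyP => m; rewrite mcoeffC.
have [->|m0] := eqVneq 0%MM m; first by rewrite mulr1.
by rewrite mulr0 (dhomog_nemf_coeff hA) // mdeg_eq0 eq_sym.
Qed.

(* Taking the constant coefficient identifies forms of order 0 with elements of
   the coefficient ring: see g2E and g3E below. *)
Definition g2 (K : fieldType) : {mpoly K[5]} :=
  let F := generic_form K 4 in (transvectant 4 4 4 F F)@_0%MM.

Definition g3 (K : fieldType) : {mpoly K[5]} :=
  let F := generic_form K 4 in
  (transvectant 4 4 4 F (transvectant 4 4 2 F F))@_0%MM.

Lemma g2E (K : fieldType) :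
  let F := generic_form K 4 in (g2 K)%:MP = transvectant 4 4 4 F F.
Proof.
move=> F; rewrite /g2 -homog0_const //.
by apply: (@transvectant_homog _ _ 4 4 4) => //; apply: binary_form_homog.
Qed.

Lemma g3E (K : fieldType) :
  let F := generic_form K 4 in
  (g3 K)%:MP = transvectant 4 4 4 F (transvectant 4 4 2 F F).
Proof.
move=> F; rewrite /g3 -homog0_const //.
apply: (@transvectant_homog _ _ 4 4 4) => //; first exact: binary_form_homog.
by apply: (@transvectant_homog _ _ 4 4 2) => //; apply: binary_form_homog.
Qed.

(* Linear substitution x_k := \sum_l M k l * x_l. *)
Definition linsubst (S : comNzRingType) (M : 'M[S]_2) (A : {mpoly S[2]}) :
    {mpoly S[2]} :=
  A \mPo [tuple \sum_(l < 2) M k l *: 'X_l | k < 2].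

Definition evalv (K : fieldType) (d : nat) (f : {mpoly K[d.+1]})
    (v : 'rV[K]_d.+1) : K := f.@[fun i => v 0 i].

Definition form_of (K : fieldType) (d : nat) (v : 'rV[K]_d.+1) :
    {mpoly K[2]} := binary_form (fun i => v 0 i).

(* [v] and [w] are the coefficient vectors of a form and its substitution. *)
Definition sl2_invariant (K : fieldType) (d : nat) (f : {mpoly K[d.+1]}) :
    Prop :=
  forall (M : 'M[K]_2) (v w : 'rV[K]_d.+1), \det M = 1 ->
    form_of w = linsubst M (form_of v) -> evalv f w = evalv f v.

(* Points of P^d are given by homogeneous coordinates; equality of points is
   proportionality, not Leibniz equality. The sets of points used below
   (closed and open sets, orbits) are all stable under proportionality. *)
Definition hpoint (K : fieldType) (d : nat) : Type :=
  {v : 'rV[K]_d.+1 | v != 0}.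

Definition homogeneous (K : fieldType) (n : nat) (f : {mpoly K[n]}) : Prop :=
  exists k : nat, f \is k.-homog.

Section Zariski.
Variables (K : fieldType) (d : nat).
Implicit Types (X Y U : hpoint K d -> Prop) (f : {mpoly K[d.+1]}).

Definition zero_locus (G : {mpoly K[d.+1]} -> Prop) : hpoint K d -> Prop :=
  fun P => forall f, G f -> evalv f (val P) = 0.

Definition zariski_closed X : Prop :=
  exists G : {mpoly K[d.+1]} -> Prop,
    (forall f, G f -> homogeneous f) /\ (forall P, X P <-> zero_locus G P).

Definition zariski_open U : Prop := zariski_closed (fun P => ~ U P).

Definition zariski_closure X : hpoint K d -> Prop :=
  fun P => forall Y, zariski_closed Y -> (forall Q, X Q -> Y Q) -> Y P.

Definition zariski_dense X : Prop := forall P, zariski_closure X P.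

Definition ideal_generated_by (G : {mpoly K[d.+1]} -> Prop)
    (p : {mpoly K[d.+1]}) : Prop :=
  exists s : seq ({mpoly K[d.+1]} * {mpoly K[d.+1]}),
    (forall x, x \in s -> G x.2) /\ p = \sum_(x <- s) x.1 * x.2.

Definition homogeneous_ideal X : {mpoly K[d.+1]} -> Prop :=
  ideal_generated_by
    (fun f => homogeneous f /\ forall P, X P -> evalv f (val P) = 0).

Definition squarefree f : Prop :=
  f != 0 /\ forall h q, f = h ^+ 2 * q -> exists c : K, h = c%:MP.

(* The degree of a hypersurface is that of its reduced equation. *)
Definition hypersurface_of_degree (e : nat) X : Prop :=
  exists f, [/\ f \is e.-homog, squarefree f &
    forall P, X P <-> zero_locus (eq f) P].

(* The scalar c accounts for forms being taken up to scalar. *)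
Definition sl2_orbit (E : hpoint K d) : hpoint K d -> Prop :=
  fun P => exists (M : 'M[K]_2) (c : K),
    [/\ \det M = 1, c != 0 &
      form_of (val P) = c *: linsubst M (form_of (val E))].

Definition Omega (E : hpoint K d) : hpoint K d -> Prop :=
  zariski_closure (sl2_orbit E).

Definition I_ (E : hpoint K d) : {mpoly K[d.+1]} -> Prop :=
  homogeneous_ideal (Omega E).

(* Depends on the chosen coordinates of E; rescaling them by c multiplies the
   value by c ^+ k when g is homogeneous of degree k. *)
Definition theta (E : hpoint K d) (g : {mpoly K[d.+1]}) : K :=
  evalv g (val E).

End Zariski.

(* Main.v *)
Require Import Defs.
From HB Require Import structures.
From mathcomp Require Import all_boot all_order all_algebra separable.
From mathcomp Require Import zify ring.
From mathcomp Require Import reals complex mpoly.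

(** The invariants g2 and g3 are 2 I and 6 J, where I and J are the classical
    invariants of the quartic (a0, .., a4) and J is the determinant of the
    Hankel matrix of the coefficients. With l = I(E)^3 / J(E)^2, the generator
    in the theorem is a nonzero scalar multiple of c = I^3 - l J^2. The open set
    consists of the quartics E with I, J and I^3 - 27 J^2 all nonzero; the last
    number is the discriminant up to a constant factor.

    Everything follows from one divisibility: a polynomial f vanishing on the
    orbit of E is a multiple of c (vanishing_on_orbit). It has two ingredients.

    - The orbit is large. A quartic with nonzero discriminant has a simple root;
      moving this root to infinity, then translating and scaling, gives the form
      4 x^3 y - I x y^3 - J y^4, so that I and J determine the quartic up to SL2
      (sl2_equiv_weierstrass). If c(v) = 0 and I(v) is nonzero, then (I(v), J(v))
      is (k^2 I(E), k^3 J(E)) for some k, whence v lies in the cone over the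
      orbit of E (sl2_equiv_of_cusp).
    - Seen as a polynomial in a4, c is a cubic with leading coefficient a0^3.
      For general values of a0, .., a3 it has three distinct roots, none of them
      a zero of I (cusp_fibre), so f vanishes at these three roots. The remainder
      of the pseudo-division of f by c, of degree at most 2 in a4, is therefore
      zero, and c divides a0^N f. As c does not vanish identically on a0 = 0, the
      factor a0^N cancels (cuspform_dvd).

    Consequently the closure of the orbit is the zero locus of c, and its ideal
    is generated by c. Squarefreeness comes for free: if c = h^2 q, then h q
    vanishes on the orbit, so c divides h q, and h is a unit. *)

Set Implicit Arguments.
Unset Strict Implicit.
Unset Printing Implicit Defensive.

Import GRing.Theory Num.Theory.

Local Open Scope ring_scope.

(** * Transvectants of forms given by normalized coefficients *)

(** Coefficients are indexed by all natural numbers, so that a derivative is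
    again such a form, with a shifted sequence of coefficients. *)
Definition nform (S : comNzRingType) (d : nat) (c : nat -> S) : {mpoly S[2]} :=
  binary_form (fun i : 'I_d.+1 => c i).

Section Derivatives.
Variable S : comNzRingType.
Implicit Types (c : nat -> S) (d k : nat).

Lemma eq_nform d c c' : c =1 c' -> nform d c = nform d c'.
Proof. by move=> ecc'; apply: eq_bigr => i _; rewrite ecc'. Qed.

Lemma mderiv_monomial1 a b :
  ('X_ix1 ^+ a * 'X_ix2 ^+ b : {mpoly S[2]})^`M(ix1) =
  a%:R *: ('X_ix1 ^+ a.-1 * 'X_ix2 ^+ b).
Proof.
rewrite !mpolyXn -!mpolyXD mderivX; congr (_%:R *: 'X_[_]).
  by rewrite mnmDE !mulmnE !mnmE /=; lia.
by apply/mnmP=> j; rewrite mnmBE !mnmDE !mulmnE !mnmE; case: j => [[|[|//]] ?] /=; lia.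
Qed.

Lemma mderiv_monomial2 a b :
  ('X_ix1 ^+ a * 'X_ix2 ^+ b : {mpoly S[2]})^`M(ix2) =
  b%:R *: ('X_ix1 ^+ a * 'X_ix2 ^+ b.-1).
Proof.
rewrite !mpolyXn -!mpolyXD mderivX; congr (_%:R *: 'X_[_]).
  by rewrite mnmDE !mulmnE !mnmE /=; lia.
by apply/mnmP=> j; rewrite mnmBE !mnmDE !mulmnE !mnmE; case: j => [[|[|//]] ?] /=; lia.
Qed.

Lemma mderiv_nform1 d c : (nform d.+1 c)^`M(ix1) = d.+1%:R *: nform d c.
Proof.
rewrite /nform /binary_form linear_sum /= big_ord_recr /=.
rewrite mderivZ mderiv_monomial1 subnn scale0r scaler0 addr0 scaler_sumr.
apply: eq_bigr => i _; rewrite mderivZ mderiv_monomial1 !scalerA /=.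
have -> : (d.+1 - i).-1 = (d - i)%N by lia.
congr (_ *: _); rewrite mulrAC mulrA -!natrM [in RHS]mul_bin_down.
by rewrite mulnC.
Qed.

Lemma mderiv_nform2 d c :
  (nform d.+1 c)^`M(ix2) = d.+1%:R *: nform d (fun i => c i.+1).
Proof.
rewrite /nform /binary_form linear_sum /= big_ord_recl /=.
rewrite mderivZ mderiv_monomial2 scale0r scaler0 add0r scaler_sumr.
apply: eq_bigr => i _; rewrite mderivZ mderiv_monomial2 !scalerA /=.
rewrite subSS; congr (_ *: _); rewrite mulrAC mulrA -!natrM [in RHS]mul_bin_diag.
by rewrite mulnC.
Qed.

Lemma mderivn_nform2 k d c :
  (nform (k + d) c)^`M(ix2, k) =
  ((k + d) ^_ k)%:R *: nform d (fun i => c (k + i)%N).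
Proof.
elim: k c => [|k IHk] c; first by rewrite mderivn0 scale1r.
rewrite mderivSn mderiv_nform2 mderivmZ IHk scalerA -natrM ffactSS.
by congr (_ *: _); apply: eq_nform => i; rewrite addSnnS.
Qed.

Lemma mderivn_nform i j d c :
  (nform (i + j + d) c)^`M(ix1, i)^`M(ix2, j) =
  ((i + j + d) ^_ (i + j))%:R *: nform d (fun l => c (j + l)%N).
Proof.
elim: i => [|i IHi]; first by rewrite mderivn0 mderivn_nform2.
by rewrite mderivSn mderiv_nform1 !mderivmZ IHi scalerA -natrM ffactSS.
Qed.

End Derivatives.

(** The factorials in the definition of the transvectant cancel the falling
    factorials produced by differentiating. *)
Lemma transvectant_nform (K : numFieldType) n r p q
    (a b : nat -> {mpoly K[n]}) :
  transvectant (r + p) (r + q) r (nform (r + p) a) (nform (r + q) b) =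
  \sum_(i < r.+1) ((-1) ^+ i * 'C(r, i)%:R) *:
     (nform p (fun l => a (i + l)%N) * nform q (fun l => b (r - i + l)%N)).
Proof.
rewrite /transvectant scaler_sumr; apply: eq_bigr => i _.
have ir : (i <= r)%N by rewrite -ltnS.
have := mderivn_nform (r - i) i p a; rewrite subnK // => ->.
have := mderivn_nform i (r - i) q b; rewrite subnKC // => ->.
rewrite -scalerAl -scalerAr !scalerA !addKn; congr (_ *: _).
have fact_neq0 m : (m`!%:R : K) != 0 by rewrite pnatr_eq0 -lt0n fact_gt0.
have normE : ((p`! * q`!)%:R / ((r + p)`! * (r + q)`!)%:R : K)%:MP *
    (((r + p) ^_ r)%:R * ((r + q) ^_ r)%:R) = 1 :> {mpoly K[n]}.
  rewrite -!mpolyC_nat -!mpolyCM; congr (_%:MP).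
  rewrite -(ffact_fact (leq_addr p r)) -(ffact_fact (leq_addr q r)) !addKn.
  rewrite !natrM; field; rewrite !fact_neq0 ?pnatr_eq0 -?lt0n ?ffact_gt0.
  by rewrite !leq_addr.
have := congr1 ( *%R ((-1) ^+ i * 'C(r, i)%:R)) normE.
by rewrite mulr1 => {2}<-; ring.
Qed.

(** * The invariants I and J *)

Definition quarticI (S : comNzRingType) (a0 a1 a2 a3 a4 : S) : S :=
  a0 * a4 - 4%:R * (a1 * a3) + 3%:R * a2 ^+ 2.

Definition quarticJ (S : comNzRingType) (a0 a1 a2 a3 a4 : S) : S :=
  a0 * a2 * a4 + 2%:R * (a1 * a2 * a3) - a2 ^+ 3 - a0 * a3 ^+ 2 - a1 ^+ 2 * a4.

(** Locked, since comparing two distinct variables by conversion would unfold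
    the representation of polynomials. *)
HB.lock Definition avar (K : numFieldType) (n i : nat) : {mpoly K[n.+1]} :=
  'X_(inord i).

Section Invariants.
Variable K : numFieldType.

Local Notation nvar := (avar K 4).

Lemma generic_quartic : generic_form K 4 = nform 4 nvar.
Proof. by apply: eq_bigr => i _; rewrite avar.unlock inord_val. Qed.

Let small_binomials :=
  ((erefl : 'C(4, 0) = 1%N, erefl : 'C(4, 1) = 4%N, erefl : 'C(4, 2) = 6%N,
    erefl : 'C(4, 3) = 4%N, erefl : 'C(4, 4) = 1%N),
  (erefl : 'C(2, 0) = 1%N, erefl : 'C(2, 1) = 2%N, erefl : 'C(2, 2) = 1%N)).

Lemma nform2 (S : comNzRingType) (c : nat -> S) :
  nform 2 c = (c 0%N)%:MP * 'X_ix1 ^+ 2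
    + 2%:R * (c 1%N)%:MP * ('X_ix1 * 'X_ix2) + (c 2%N)%:MP * 'X_ix2 ^+ 2.
Proof.
rewrite /nform /binary_form !big_ord_recr big_ord0 /= add0r.
rewrite -!mul_mpolyC !small_binomials ?mpolyCM ?mpolyC_nat ?subnn ?subn0; ring.
Qed.

Lemma nform4 (S : comNzRingType) (c : nat -> S) :
  nform 4 c = (c 0%N)%:MP * 'X_ix1 ^+ 4
    + 4%:R * (c 1%N)%:MP * ('X_ix1 ^+ 3 * 'X_ix2)
    + 6%:R * (c 2%N)%:MP * ('X_ix1 ^+ 2 * 'X_ix2 ^+ 2)
    + 4%:R * (c 3%N)%:MP * ('X_ix1 * 'X_ix2 ^+ 3) + (c 4%N)%:MP * 'X_ix2 ^+ 4.
Proof.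
rewrite /nform /binary_form !big_ord_recr big_ord0 /= add0r.
rewrite -!mul_mpolyC !small_binomials ?mpolyCM ?mpolyC_nat ?subSS ?subn0; ring.
Qed.

Lemma nform0 (S : comNzRingType) (c : nat -> S) : nform 0 c = (c 0%N)%:MP.
Proof.
by rewrite /nform /binary_form big_ord1 bin0 !expr0 mulr1 mul1r -mul_mpolyC mulr1.
Qed.

Lemma g2_quarticI :
  g2 K = 2%:R * quarticI (nvar 0) (nvar 1) (nvar 2) (nvar 3) (nvar 4).
Proof.
rewrite /g2 generic_quartic (@transvectant_nform K 5 4 0 0).
rewrite !big_ord_recr big_ord0 /= !nform0 /bump /= -!mpolyCM.
rewrite add0r -!mul_mpolyC -!mpolyCM -!mpolyCD mcoeffC eqxx.
rewrite !small_binomials ?addn0 ?subSS ?subn0 /= mulr1 /quarticI; ring.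
Qed.

(** The middle coefficient of the Hessian has denominator 3 and is therefore
    specified by its triple. *)
Lemma hessian_quartic (a h : nat -> {mpoly K[5]}) :
  h 0%N = 2%:R * (a 0%N * a 2%N - a 1%N ^+ 2) ->
  h 1%N = a 0%N * a 3%N - a 1%N * a 2%N ->
  3%:R * h 2%N = a 0%N * a 4%N + 2%:R * (a 1%N * a 3%N) - 3%:R * a 2%N ^+ 2 ->
  h 3%N = a 1%N * a 4%N - a 2%N * a 3%N ->
  h 4%N = 2%:R * (a 2%N * a 4%N - a 3%N ^+ 2) ->
  transvectant 4 4 2 (nform 4 a) (nform 4 a) = nform 4 h.
Proof.
move=> h0 h1 h2 h3 h4; rewrite (@transvectant_nform K 5 2 2 2).
rewrite !big_ord_recr big_ord0 /= add0r !nform2 nform4 h0 h1 h3 h4 -!mul_mpolyC.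
have -> : 6%:R * (h 2%N)%:MP = 2%:R * (3%:R * h 2%N)%:MP :> {mpoly {mpoly K[5]}[2]}.
  by rewrite mpolyCM mpolyC_nat mulrA -natrM.
rewrite h2 !small_binomials ?add0n ?add1n ?add2n ?(mpolyCD, mpolyCB, mpolyCM, mpolyC_nat).
by rewrite ?(rmorphXn, rmorphN, rmorph1) /=; ring.
Qed.

Lemma g3_quarticJ :
  g3 K = 6%:R * quarticJ (nvar 0) (nvar 1) (nvar 2) (nvar 3) (nvar 4).
Proof.
pose h2 := (3%:R^-1)%:MP *
  (nvar 0 * nvar 4 + 2%:R * (nvar 1 * nvar 3) - 3%:R * nvar 2 ^+ 2).
have h2E :
    3%:R * h2 = nvar 0 * nvar 4 + 2%:R * (nvar 1 * nvar 3) - 3%:R * nvar 2 ^+ 2.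
  have third : 3%:R * (3%:R^-1)%:MP = 1 :> {mpoly K[5]}.
    by rewrite -[X in X * _]mpolyC_nat -mpolyCM mulfV ?pnatr_eq0 // mpolyC1.
  by rewrite /h2 mulrA third mul1r.
pose h := nth 0 [:: 2%:R * (nvar 0 * nvar 2 - nvar 1 ^+ 2);
  nvar 0 * nvar 3 - nvar 1 * nvar 2; h2; nvar 1 * nvar 4 - nvar 2 * nvar 3;
  2%:R * (nvar 2 * nvar 4 - nvar 3 ^+ 2)].
rewrite /g3 generic_quartic (@hessian_quartic _ h) // (@transvectant_nform K 5 4 0 0).
rewrite !big_ord_recr big_ord0 /= !nform0 /bump /= -!mpolyCM.
rewrite add0r -!mul_mpolyC -!mpolyCM -!mpolyCD mcoeffC eqxx.
rewrite !small_binomials ?addn0 ?subSS ?subn0 /= mulr1 /quarticJ.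
have -> : (-1) ^+ 2 * 6%:R * (nvar 2 * h2) = 2%:R * nvar 2 * (3%:R * h2) by ring.
by rewrite h2E /h /=; ring.
Qed.

End Invariants.

(** * Polynomials in n + 1 variables as polynomials in the last variable *)

Section Muni.
Variables (S : comNzRingType) (n : nat).

(** A left inverse of [muni] (see [muniK]). *)
Definition unmuni (h : {poly {mpoly S[n]}}) : {mpoly S[n.+1]} :=
  (map_poly (@mwiden n S) h).['X_ord_max].

Lemma unmuni_is_additive : additive unmuni.
Proof. by move=> p q; rewrite /unmuni rmorphB hornerD hornerN. Qed.

HB.instance Definition _ :=
  GRing.isAdditive.Build {poly {mpoly S[n]}} {mpoly S[n.+1]} unmuni
    unmuni_is_additive.

Lemma unmuniM p q : unmuni (p * q) = unmuni p * unmuni q.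
Proof. by rewrite /unmuni rmorphM hornerM. Qed.

Lemma unmuniC c : unmuni c%:P = mwiden c.
Proof. by rewrite /unmuni map_polyC hornerC. Qed.

Lemma unmuniXn k : unmuni 'X^k = 'X_ord_max ^+ k.
Proof. by rewrite /unmuni map_polyXn hornerXn. Qed.

Lemma muniK : cancel (@muni n S) unmuni.
Proof.
move=> p; rewrite muniE raddf_sum [RHS]mpolyE; apply: eq_bigr => m _.
rewrite /= -mul_polyC unmuniM unmuniC unmuniXn mwidenZ mwidenX -scalerAl.
rewrite mpolyXn -mpolyXD; congr (_ *: 'X_[_]).
apply/mnmP=> i; rewrite mnmDE mulmnE mnm1E.
case: (unliftP ord_max i) => [j ->|->].
  have -> : lift ord_max j = widen_ord (leqnSn n) j by apply/val_inj/lift_max.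
  rewrite mnmwiden_widen mnmE eqE /= gtn_eqF ?ltn_ord //= mul0n addn0.
  by congr (m _); apply/val_inj.
by rewrite mnmwiden_ordmax eqxx mul1n.
Qed.

Lemma muniX (m : 'X_{1..n.+1}) :
  muni ('X_[m] : {mpoly S[n.+1]}) =
  'X_[[multinom m (widen_ord (leqnSn n) i) | i < n]] *: 'X^(m ord_max).
Proof. by rewrite muniE msuppX big_seq1 mcoeffX eqxx scale1r. Qed.

Lemma muni_widen (i : 'I_n) :
  muni ('X_(widen_ord (leqnSn n) i) : {mpoly S[n.+1]}) = ('X_i)%:P.
Proof.
rewrite muniX mnm1E eqE /= ltn_eqF ?ltn_ord // expr0 alg_polyC.
congr ('X_[_])%:P; apply/mnmP => j; rewrite mnmE !mnm1E.
by congr (nat_of_bool _); apply/eqP/eqP => [/(congr1 val)/val_inj|->].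
Qed.

Lemma muni_max : muni ('X_ord_max : {mpoly S[n.+1]}) = 'X.
Proof.
rewrite muniX mnm1E eqxx expr1.
rewrite (_ : [multinom _ | i < n] = 0%MM) ?mpolyX0 ?scale1r //.
by apply/mnmP => j; rewrite mnmE mnm1E mnm0E eqE /= gtn_eqF ?ltn_ord.
Qed.

Lemma meval_muni (v : 'I_n.+1 -> S) p :
  p.@[v] = (map_poly (meval (fun i => v (widen_ord (leqnSn n) i))) (muni p)).[v ord_max].
Proof.
rewrite -[p in LHS]muniK /unmuni.
elim/poly_ind: (muni p) => [|q c IHq]; first by rewrite !rmorph0 !horner0 rmorph0.
rewrite !rmorphD !rmorphM /= !map_polyX !map_polyC /= !hornerMXaddC.
rewrite rmorphD rmorphM /= IHq mevalXU; congr (_ + _).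
elim/mpolyind: c => [|c m p' _ _ IH]; first by rewrite mwiden0 !meval0.
rewrite mwidenD mwidenZ mwidenX !mevalD !mevalZ !mevalX IH big_ord_recr /=.
rewrite mnmwiden_ordmax expr0 mulr1; congr (_ * _ + _).
by apply: eq_bigr => i _; rewrite mnmwiden_widen.
Qed.

End Muni.

Section Infinite.
Variable K : numFieldType.

Definition extend n (b : 'I_n -> K) (x : K) (i : 'I_n.+1) : K :=
  oapp b x (unlift ord_max i).

Lemma horner_muni n (b : 'I_n -> K) x (p : {mpoly K[n.+1]}) :
  (map_poly (meval b) (muni p)).[x] = p.@[extend b x].
Proof.
rewrite meval_muni /extend unlift_none /=; congr _.[_].
apply: eq_map_poly => r; apply: meval_eq => i /=.
have -> : widen_ord (leqnSn n) i = lift ord_max i by apply/val_inj/esym/lift_max.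
by rewrite liftK.
Qed.

Lemma poly_eq0_horner (p : {poly K}) : (forall x, p.[x] = 0) -> p = 0.
Proof.
move=> p0; apply/eqP; apply/negPn/negP => nz_p.
have := @max_poly_roots _ p [seq k%:R | k <- iota 0 (size p)] nz_p.
rewrite size_map size_iota ltnn => absurd; apply: notF; apply: absurd.
  by apply/allP => x _; rewrite rootE p0.
by rewrite map_inj_uniq ?iota_uniq // => i j /eqP; rewrite eqr_nat => /eqP.
Qed.

Lemma mpoly_eq0_meval n (p : {mpoly K[n]}) : (forall v, p.@[v] = 0) -> p = 0.
Proof.
elim: n p => [|n IHn] p p0.
  apply/mpolyP => m; rewrite mcoeff0.
  have m0 (m' : 'X_{1..0}) : m' = 0%MM by apply/mnmP; case.
  rewrite (m0 m) -[RHS](p0 (fun=> 0)) mevalE.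
  rewrite [p in p@_ _]mpolyE raddf_sum /=; apply: eq_bigr => m' _.
  by rewrite mcoeffZ mcoeffX (m0 m') eqxx big_ord0.
suffices : muni p = 0 by move=> /(congr1 (@unmuni _ n)); rewrite muniK raddf0.
apply/polyP => k; rewrite coef0; apply: IHn => v.
pose q := map_poly (meval v) (muni p).
have -> : ((muni p)`_k).@[v] = q`_k by rewrite coef_map.
suffices -> : q = 0 by rewrite coef0.
apply: poly_eq0_horner => x.
rewrite -[RHS](p0 (extend v x)); exact: horner_muni.
Qed.

(** Where D does not vanish, the pseudo-remainder of f by P specializes to a
    polynomial with more roots than its degree allows; its coefficients thus
    vanish on a dense set, hence identically. *)
Lemma pseudo_dvd_of_fibres n (P f : {poly {mpoly K[n]}}) (D : {mpoly K[n]}) :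
    P != 0 -> D != 0 ->
    (forall b, D.@[b] != 0 -> exists rs : seq K,
       [/\ uniq rs, (size P <= (size rs).+1)%N &
          forall x, x \in rs -> (map_poly (meval b) P).[x] = 0 /\
                                (map_poly (meval b) f).[x] = 0]) ->
  exists k q, lead_coef P ^+ k *: f = q * P.
Proof.
move=> nz_P nz_D roots.
pose r := Pdiv.Idomain.modp f P.
exists (Pdiv.Idomain.scalp f P), (Pdiv.Idomain.divp f P).
rewrite Pdiv.Idomain.divp_eq -/r.
suffices -> : r = 0 by rewrite addr0.
have size_r : (size r < size P)%N by rewrite Pdiv.Idomain.ltn_modp.
apply/polyP => j; rewrite coef0; apply: (mulfI nz_D); rewrite mulr0.
apply: mpoly_eq0_meval => b; rewrite mevalM.
have [->|nz_Db] := eqVneq (D.@[b]) 0; first by rewrite mul0r.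
have [rs [uniq_rs size_rs rootsE]] := roots b nz_Db.
pose rb := map_poly (meval b) r.
have -> : (r`_j).@[b] = rb`_j by rewrite coef_map.
suffices -> : rb = 0 by rewrite coef0 mulr0.
apply/eqP; apply: contraT => nz_rb.
have := max_poly_roots nz_rb _ uniq_rs.
suffices all_rs : all (root rb) rs.
  move/(_ all_rs)/leq_trans/(_ (size_poly _ _)); rewrite leqNgt.
  by rewrite (leq_trans size_r size_rs).
apply/allP => x /rootsE[Px fx]; rewrite rootE.
have := congr1 (fun p => (map_poly (meval b) p).[x]) (Pdiv.Idomain.divp_eq f P).
rewrite /= map_polyZ hornerZ fx mulr0 rmorphD rmorphM hornerD hornerM Px mulr0 add0r.
by move=> <-.
Qed.

Lemma mpoly_pseudo_dvd n (P f : {mpoly K[n.+1]}) (D : {mpoly K[n]}) d c :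
    size (muni P) = d.+1 -> lead_coef (muni P) = c -> D != 0 ->
    (forall b, D.@[b] != 0 -> exists rs : seq K,
       [/\ uniq rs, size rs = d & forall x, x \in rs ->
          P.@[extend b x] = 0 /\ f.@[extend b x] = 0]) ->
  exists k q, mwiden c ^+ k * f = q * P.
Proof.
move=> size_P <- nz_D roots.
have nz_P : muni P != 0 by rewrite -size_poly_eq0 size_P.
have [|k [q qE]] := @pseudo_dvd_of_fibres n (muni P) (muni f) D nz_P nz_D.
  move=> b /roots[rs [uniq_rs size_rs rsP]]; exists rs.
  split; [exact: uniq_rs | by rewrite size_P size_rs | move=> x /rsP[Px fx]].
  split; first by rewrite -[RHS]Px; apply: horner_muni.
  by rewrite -[RHS]fx; apply: horner_muni.
exists k, (unmuni q).
rewrite -(rmorphXn (@mwiden n K)) /= -unmuniC -[f in LHS]muniK -unmuniM.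
by rewrite mul_polyC qE unmuniM muniK.
Qed.

(** * Cancelling a variable *)

Section KillVariable.
Variables (n : nat) (i : 'I_n).

Definition kill_var (p : {mpoly K[n]}) : {mpoly K[n]} :=
  p \mPo [tuple if j == i then 0 else 'X_j | j < n].

Lemma kill_varP p : exists q, p = kill_var p + 'X_i * q.
Proof.
elim/mpolyind: p => [|c m p _ _ [q pE]].
  by exists 0; rewrite /kill_var comp_mpoly0 mulr0 addr0.
suffices [q' mE] : exists q', 'X_[m] = kill_var 'X_[m] + 'X_i * q'.
  exists (c *: q' + q); rewrite {1}pE {1}mE /kill_var comp_mpolyD comp_mpolyZ.
  by rewrite mulrDr -scalerAr scalerDr addrACA.
rewrite /kill_var comp_mpolyX; have [m0|m_gt0] := posnP (m i).
  exists 0; rewrite mulr0 addr0 [LHS]mpolyXE_id; apply: eq_bigr => j _.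
  by rewrite tnth_mktuple; case: eqP => // ->; rewrite m0 !expr0.
exists 'X_[m - U_(i)].
rewrite (bigD1 i) //= tnth_mktuple eqxx expr0n eqn0Ngt m_gt0 mul0r add0r.
rewrite -mpolyXD addmC submK //; apply/mnm_lepP => j; rewrite mnm1E.
by case: eqP => // <-.
Qed.

Lemma meval_kill_var p v : v i = 0 -> (kill_var p).@[v] = p.@[v].
Proof.
move=> vi0; rewrite comp_mpoly_meval; apply: meval_eq => j.
by rewrite tnth_mktuple; case: eqP => [->|_]; rewrite ?meval0 ?mevalXU.
Qed.

(** A variable is prime: if it divides q P but not P, it divides q. That it
    does not divide P is witnessed by a point of the coordinate hyperplane. *)
Lemma dvd_cancel_var k (P f q : {mpoly K[n]}) v :
  v i = 0 -> P.@[v] != 0 -> 'X_i ^+ k * f = q * P -> exists q', f = q' * P.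
Proof.
move=> vi0 nz_Pv; elim: k f q => [|k IHk] f q; first by rewrite mul1r => ->; exists q.
move=> fE; have [q' qE] := kill_varP q.
have nz_X : 'X_i != 0 :> {mpoly K[n]}.
  by apply/eqP => /(congr1 (meval (fun=> 1)))/eqP; rewrite mevalXU meval0 oner_eq0.
have kill_q : kill_var q = 0.
  have : kill_var q * kill_var P = 0.
    rewrite /kill_var -rmorphM /= -fE exprS -mulrA rmorphM /= comp_mpolyXU.
    by rewrite -tnth_nth tnth_mktuple eqxx mul0r.
  move/eqP; rewrite mulf_eq0 => /orP[/eqP //|/eqP kill_P].
  by case/eqP: nz_Pv; rewrite -meval_kill_var // kill_P meval0.
apply: (IHk _ q'); apply: (mulfI nz_X).
by rewrite !mulrA -exprS fE qE kill_q add0r.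
Qed.

End KillVariable.
End Infinite.

(** * Quartics up to SL2 *)

Lemma mevalXn (S : comNzRingType) n (u : 'I_n -> S) (p : {mpoly S[n]}) k :
  (p ^+ k).@[u] = p.@[u] ^+ k.
Proof. exact: rmorphXn. Qed.

Lemma meval_nat (S : comNzRingType) n (u : 'I_n -> S) k :
  (k%:R : {mpoly S[n]}).@[u] = k%:R.
Proof. exact: rmorph_nat. Qed.

Section Quartics.
Variable K : numClosedFieldType.
Implicit Types (v w : 'rV[K]_5) (x y : K).

Definition qcoef v (i : nat) : K := v 0 (inord i).

Definition quartic (a0 a1 a2 a3 a4 : K) : 'rV[K]_5 :=
  \row_i nth 0 [:: a0; a1; a2; a3; a4] i.

Lemma qcoef_quartic a0 a1 a2 a3 a4 (q := qcoef (quartic a0 a1 a2 a3 a4)) :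
  (q 0%N = a0) * (q 1%N = a1) * (q 2%N = a2) * (q 3%N = a3) * (q 4%N = a4).
Proof. by rewrite /q /qcoef !mxE !inordK. Qed.

Lemma quartic_qcoef v :
  v = quartic (qcoef v 0) (qcoef v 1) (qcoef v 2) (qcoef v 3) (qcoef v 4).
Proof.
apply/rowP => i; rewrite mxE /qcoef.
by case: i => [[|[|[|[|[|//]]]]] ?] /=; congr (v 0 _); apply/val_inj; rewrite /= inordK.
Qed.

Lemma qcoefZ c v i : qcoef (c *: v) i = c * qcoef v i.
Proof. by rewrite /qcoef mxE. Qed.

Definition qval v x y : K :=
  qcoef v 0 * x ^+ 4 + 4%:R * qcoef v 1 * (x ^+ 3 * y)
    + 6%:R * qcoef v 2 * (x ^+ 2 * y ^+ 2) + 4%:R * qcoef v 3 * (x * y ^+ 3)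
    + qcoef v 4 * y ^+ 4.

Definition point2 x y (k : 'I_2) : K := if k == ix1 then x else y.

Lemma meval_form_of v x y : (form_of v).@[point2 x y] = qval v x y.
Proof.
have -> : form_of v = nform 4 (qcoef v).
  by apply: eq_bigr => i _; rewrite /qcoef inord_val.
rewrite nform4 !mevalD; congr (_ + _ + _ + _ + _).
- by rewrite mevalM mevalXn mevalC mevalXU.
- by rewrite 3!mevalM mevalXn mevalC !mevalXU meval_nat.
- by rewrite 3!mevalM !mevalXn mevalC !mevalXU meval_nat.
- by rewrite 3!mevalM mevalXn mevalC !mevalXU meval_nat.
by rewrite mevalM mevalXn mevalC mevalXU.
Qed.

Lemma qvalZ c v x y : qval (c *: v) x y = c * qval v x y.
Proof. by rewrite /qval !qcoefZ; ring. Qed.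

(** The coefficients are recovered from the values at (1,0), (0,1), (1,1),
    (1,-1) and (2,1). *)
Lemma qval_inj v w : (forall x y, qval v x y = qval w x y) -> v = w.
Proof.
move=> evw; pose f x y := qval v x y - qval w x y.
have f0 x y : f x y = 0 by rewrite /f evw subrr.
have cancel_nat k (z z' : K) : k.+1%:R * (z - z') = 0 -> z = z'.
  by move/eqP; rewrite mulf_eq0 pnatr_eq0 subr_eq0 => /eqP.
rewrite (quartic_qcoef v) (quartic_qcoef w); congr quartic.
- apply: (@cancel_nat 0); transitivity (f 1 0); last by rewrite f0.
  by rewrite /f /qval; ring.
- apply: (@cancel_nat 23); transitivity
    (f 2%:R 1 - 12%:R * f 1 0 + 3%:R * f 0 1 - 3%:R * f 1 1 - f 1 (-1)).
    by rewrite /f /qval; ring.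
  by rewrite !f0; ring.
- apply: (@cancel_nat 11); transitivity
    (f 1 1 + f 1 (-1) - 2%:R * f 1 0 - 2%:R * f 0 1).
    by rewrite /f /qval; ring.
  by rewrite !f0; ring.
- apply: (@cancel_nat 23); transitivity
    (6%:R * f 1 1 - 2%:R * f 1 (-1) - f 2%:R 1 + 12%:R * f 1 0 - 3%:R * f 0 1).
    by rewrite /f /qval; ring.
  by rewrite !f0; ring.
- apply: (@cancel_nat 0); transitivity (f 0 1); last by rewrite f0.
  by rewrite /f /qval; ring.
Qed.

(** The coefficients of the form obtained from [v] by the substitution
    x := a x + b y, y := c x + d y (see [qval_qsubst]). *)
Definition qsubst (a b c d : K) v : 'rV[K]_5 :=
  let q := qcoef v in
  quartic
    (q 0%N * a ^+ 4 + 4%:R * q 1%N * (a ^+ 3 * c) + 6%:R * q 2%N * (a ^+ 2 * c ^+ 2)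
      + 4%:R * q 3%N * (a * c ^+ 3) + q 4%N * c ^+ 4)
    (q 0%N * (a ^+ 3 * b) + q 1%N * (a ^+ 3 * d + 3%:R * (a ^+ 2 * b * c))
      + 3%:R * q 2%N * (a ^+ 2 * c * d + a * b * c ^+ 2)
      + q 3%N * (3%:R * (a * c ^+ 2 * d) + b * c ^+ 3) + q 4%N * (c ^+ 3 * d))
    (q 0%N * (a ^+ 2 * b ^+ 2) + 2%:R * q 1%N * (a ^+ 2 * b * d + a * b ^+ 2 * c)
      + q 2%N * (a ^+ 2 * d ^+ 2 + 4%:R * (a * b * c * d) + b ^+ 2 * c ^+ 2)
      + 2%:R * q 3%N * (a * c * d ^+ 2 + b * c ^+ 2 * d) + q 4%N * (c ^+ 2 * d ^+ 2))
    (q 0%N * (a * b ^+ 3) + q 1%N * (3%:R * (a * b ^+ 2 * d) + b ^+ 3 * c)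
      + 3%:R * q 2%N * (a * b * d ^+ 2 + b ^+ 2 * c * d)
      + q 3%N * (a * d ^+ 3 + 3%:R * (b * c * d ^+ 2)) + q 4%N * (c * d ^+ 3))
    (q 0%N * b ^+ 4 + 4%:R * q 1%N * (b ^+ 3 * d) + 6%:R * q 2%N * (b ^+ 2 * d ^+ 2)
      + 4%:R * q 3%N * (b * d ^+ 3) + q 4%N * d ^+ 4).

Lemma qval_qsubst a b c d v x y :
  qval (qsubst a b c d v) x y = qval v (a * x + b * y) (c * x + d * y).
Proof. rewrite /qval !qcoef_quartic; ring. Qed.

Definition invI v : K :=
  quarticI (qcoef v 0) (qcoef v 1) (qcoef v 2) (qcoef v 3) (qcoef v 4).
Definition invJ v : K :=
  quarticJ (qcoef v 0) (qcoef v 1) (qcoef v 2) (qcoef v 3) (qcoef v 4).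

Lemma invI_qsubst a b c d v : invI (qsubst a b c d v) = (a * d - b * c) ^+ 4 * invI v.
Proof. rewrite /invI !qcoef_quartic /quarticI; ring. Qed.

Lemma invJ_qsubst a b c d v : invJ (qsubst a b c d v) = (a * d - b * c) ^+ 6 * invJ v.
Proof. rewrite /invJ !qcoef_quartic /quarticJ; ring. Qed.

Lemma invIZ k v : invI (k *: v) = k ^+ 2 * invI v.
Proof. by rewrite /invI /quarticI !qcoefZ; ring. Qed.

Lemma invJZ k v : invJ (k *: v) = k ^+ 3 * invJ v.
Proof. by rewrite /invJ /quarticJ !qcoefZ; ring. Qed.

(** The scalar k is recorded because I and J scale by k^2 and k^3. *)
Definition sl2_equiv k v w : Prop :=
  exists a b c d : K, a * d - b * c = 1 /\ w = k *: qsubst a b c d v.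

Lemma sl2_equivP k v w : sl2_equiv k v w <->
  exists a b c d : K, a * d - b * c = 1 /\
    forall x y, qval w x y = k * qval v (a * x + b * y) (c * x + d * y).
Proof.
split=> -[a [b [c [d [det1 wE]]]]]; exists a, b, c, d; split=> //.
  by move=> x y; rewrite wE qvalZ qval_qsubst.
by apply: qval_inj => x y; rewrite wE qvalZ qval_qsubst.
Qed.

Lemma sl2_equiv_sym k v w : k != 0 -> sl2_equiv k v w -> sl2_equiv k^-1 w v.
Proof.
move=> nz_k /sl2_equivP[a [b [c [d [det1 wE]]]]]; apply/sl2_equivP.
exists d, (- b), (- c), a; split=> [|x y]; first by rewrite -det1; ring.
rewrite wE mulKf //; congr qval.
  by rewrite -[LHS]mul1r -det1; ring.
by rewrite -[LHS]mul1r -det1; ring.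
Qed.

Lemma sl2_equiv_trans k l u v w :
  sl2_equiv k u v -> sl2_equiv l v w -> sl2_equiv (l * k) u w.
Proof.
move=> /sl2_equivP[a [b [c [d [det1 vE]]]]].
move=> /sl2_equivP[a' [b' [c' [d' [det1' wE]]]]]; apply/sl2_equivP.
exists (a * a' + b * c'), (a * b' + b * d'), (c * a' + d * c'), (c * b' + d * d').
split=> [|x y].
  transitivity ((a * d - b * c) * (a' * d' - b' * c')); first by ring.
  by rewrite det1 det1' mulr1.
by rewrite wE vE mulrA; congr (_ * qval _ _ _); ring.
Qed.

Lemma sl2_equiv_inv k v w : sl2_equiv k v w ->
  invI w = k ^+ 2 * invI v /\ invJ w = k ^+ 3 * invJ v.
Proof.
move=> [a [b [c [d [det1 ->]]]]].
by rewrite invIZ invJZ invI_qsubst invJ_qsubst det1 !expr1n !mul1r.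
Qed.

(** The discriminant of the quartic, up to a constant factor. *)
Definition disc v : K := invI v ^+ 3 - 27%:R * invJ v ^+ 2.

(** Moves a root of the quartic to infinity: after the substitution, the leading
    coefficient is the value of the original form at that root. *)
Lemma sl2_equiv_root v : exists w, sl2_equiv 1 v w /\ qcoef w 0 = 0.
Proof.
have [v0|nz_v0] := eqVneq (qcoef v 0) 0.
  exists (1 *: qsubst 1 0 0 1 v); split; first by exists 1, 0, 0, 1; split=> //; ring.
  by rewrite qcoefZ !qcoef_quartic v0; ring.
pose p := Poly [:: qcoef v 4; 4%:R * qcoef v 3; 6%:R * qcoef v 2;
                   4%:R * qcoef v 1; qcoef v 0].
have size_p : size p != 1%N by rewrite (@PolyK _ 0).
have [r] := closed_rootP p size_p.
rewrite rootE horner_Poly /= => /eqP pr.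
exists (1 *: qsubst r (-1) 1 0 v); split.
  by exists r, (-1), 1, 0; split=> //; ring.
by rewrite qcoefZ !qcoef_quartic -pr; ring.
Qed.

(** The Weierstrass form: with a root at infinity, the coefficient of x^3 y
    scaled to 4 and that of x^2 y^2 cleared by a translation, only two
    coefficients are left, and these are determined by I and J. *)
Lemma sl2_equiv_weierstrass v : disc v != 0 ->
  sl2_equiv 1 v (quartic 0 1 0 (- (invI v / 4%:R)) (- invJ v)).
Proof.
have [u [v_u u0]] := sl2_equiv_root v.
have [Iu Ju] := sl2_equiv_inv v_u; rewrite !expr1n !mul1r in Iu Ju.
rewrite /disc -Iu -Ju => disc_u.
(* If the first two coefficients vanish, the root at infinity is multiple. *)
have nz_u1 : qcoef u 1 != 0.
  apply: contraNneq disc_u => u1.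
  by rewrite /invI /invJ /quarticI /quarticJ u0 u1; apply/eqP; ring.
have nz4 : 4%:R != 0 :> K by rewrite pnatr_eq0.
(* The substitution x := s x + t y, y := y / s. *)
pose s := sqrtC (qcoef u 1)^-1.
have s2 : s ^+ 2 = (qcoef u 1)^-1 by rewrite sqrtCK.
have nz_s : s != 0.
  by have : s ^+ 2 != 0 by [rewrite s2 invr_eq0]; rewrite expf_eq0.
pose t := - qcoef u 2 / (2%:R * qcoef u 1 * s).
pose w := qsubst s t 0 s^-1 u.
have u_w : sl2_equiv 1 u w.
  by exists s, t, 0, s^-1; rewrite scale1r mulr0 subr0 mulfV.
suffices <- : w = quartic 0 1 0 (- (invI u / 4%:R)) (- invJ u).
  by have := sl2_equiv_trans v_u u_w; rewrite mulr1.
have [Iw Jw] := sl2_equiv_inv u_w; rewrite !expr1n !mul1r in Iw Jw.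
have w0 : qcoef w 0 = 0 by rewrite !qcoef_quartic u0; ring.
have w1 : qcoef w 1 = 1.
  transitivity (qcoef u 1 * s ^+ 2); last by rewrite s2 mulfV.
  by rewrite !qcoef_quartic u0; field; rewrite nz_s.
have w2 : qcoef w 2 = 0.
  rewrite !qcoef_quartic u0 /t; field.
  by rewrite nz_s nz_u1.
rewrite -Iw -Jw [LHS]quartic_qcoef w0 w1 w2 /invI /invJ /quarticI /quarticJ w0 w1 w2.
by congr quartic; field.
Qed.

Lemma sl2_equiv_of_inv v w : disc v != 0 ->
  invI v = invI w -> invJ v = invJ w -> sl2_equiv 1 v w.
Proof.
move=> disc_v eqI eqJ.
have disc_w : disc w != 0 by rewrite /disc -eqI -eqJ.
have := sl2_equiv_sym (oner_neq0 K) (sl2_equiv_weierstrass disc_w).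
rewrite -eqI -eqJ => w_v; have := sl2_equiv_trans (sl2_equiv_weierstrass disc_v) w_v.
by rewrite invr1 mulr1.
Qed.

(** The rational parametrization of the cuspidal curve: a point (I, J) of the
    curve through (I(e), J(e)) has the form (k^2 I(e), k^3 J(e)), and k is the
    quotient of J / J(e) by I / I(e). *)
Lemma sl2_equiv_of_cusp e v : invI e != 0 -> invJ e != 0 -> disc e != 0 ->
  invI v != 0 -> invJ e ^+ 2 * invI v ^+ 3 = invI e ^+ 3 * invJ v ^+ 2 ->
  exists2 k, k != 0 & sl2_equiv k e v.
Proof.
move=> nz_Ie nz_Je disc_e nz_Iv cusp.
have nz_Jv : invJ v != 0.
  apply: contraNneq nz_Iv => Jv0; move/eqP: cusp.
  by rewrite Jv0 expr0n mulr0 mulf_eq0 !expf_eq0 /= (negPf nz_Je).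
pose k := invJ v * invI e / (invJ e * invI v).
have nz_k : k != 0 by rewrite !mulf_neq0 ?invr_eq0 ?mulf_neq0.
have k2 : k ^+ 2 * invI e = invI v.
  transitivity (invI e ^+ 3 * invJ v ^+ 2 / (invJ e ^+ 2 * invI v ^+ 2)).
    by rewrite /k; field; rewrite nz_Iv nz_Je.
  by rewrite -cusp; field; rewrite nz_Iv nz_Je.
have k3 : k ^+ 3 * invJ e = invJ v.
  transitivity (k * (k ^+ 2 * invI e) * invJ e / invI e); first by field.
  by rewrite k2 /k; field; rewrite ?nz_Ie ?nz_Je ?nz_Iv.
exists k => //; have e_v : sl2_equiv 1 e (k^-1 *: v).
  apply: sl2_equiv_of_inv => //.
    by rewrite invIZ -k2; field.
  by rewrite invJZ -k3; field.
have [a [b [c [d [det1 vE]]]]] := e_v; exists a, b, c, d; split=> //.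
by rewrite -[qsubst _ _ _ _ _]scale1r -vE scalerA mulfV // scale1r.
Qed.

End Quartics.

(** * The fibres of the projection forgetting a4 *)

Section Cusp.
Variable K : numClosedFieldType.

(** The leading coefficient of the Hessian covariant, up to a factor. *)
Definition semiH (S : comNzRingType) (a0 a1 a2 : S) : S := a0 * a2 - a1 ^+ 2.

(** T^2 + 4 H^3, where T is the leading coefficient of the sextic covariant. *)
Definition semiG (S : comNzRingType) (a0 a1 a2 a3 : S) : S :=
  (a0 ^+ 2 * a3 - 3%:R * (a0 * a1 * a2) + 2%:R * a1 ^+ 3) ^+ 2
    + 4%:R * semiH a0 a1 a2 ^+ 3.

(** The classical syzygy between the covariants of a quartic, read off on the
    leading coefficients. *)
Lemma quartic_syzygy (S : comNzRingType) (a0 a1 a2 a3 a4 : S) :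
  semiG a0 a1 a2 a3 =
  a0 ^+ 2 * semiH a0 a1 a2 * quarticI a0 a1 a2 a3 a4
    - a0 ^+ 3 * quarticJ a0 a1 a2 a3 a4.
Proof. by rewrite /semiG /semiH /quarticI /quarticJ; ring. Qed.

(** Both I and J are affine functions of a4, so I^3 - l J^2 is a cubic in a4. At
    a common root with its derivative, the syzygy gives 3 a0 J = 2 H I and
    8 l H^3 = 27 a0^3 J, hence 27 (T^2 + 4 H^3) = 4 l H^3, so the roots are
    simple. At a root where I = 0, also J = 0 and then T^2 + 4 H^3 = 0. *)
Lemma cusp_fibre (l a0 a1 a2 a3 : K) :
    l != 0 -> a0 != 0 -> semiG a0 a1 a2 a3 != 0 ->
    27%:R * semiG a0 a1 a2 a3 - 4%:R * l * semiH a0 a1 a2 ^+ 3 != 0 ->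
  exists rs : seq K, [/\ uniq rs, size rs = 3%N & forall x, x \in rs ->
    quarticI a0 a1 a2 a3 x != 0 /\
    quarticI a0 a1 a2 a3 x ^+ 3 = l * quarticJ a0 a1 a2 a3 x ^+ 2].
Proof.
move=> nz_l nz_a0 nz_G nz_disc.
have syz x := quartic_syzygy a0 a1 a2 a3 x.
move: nz_G nz_disc syz.
set h := semiH _ _ _; set g := semiG _ _ _ _ => nz_G nz_disc syz.
pose i0 := - (4%:R * (a1 * a3)) + 3%:R * a2 ^+ 2.
pose j0 := 2%:R * (a1 * a2 * a3) - a2 ^+ 3 - a0 * a3 ^+ 2.
pose pI : {poly K} := a0%:P * 'X + i0%:P.
pose pJ : {poly K} := h%:P * 'X + j0%:P.
have IE x : pI.[x] = quarticI a0 a1 a2 a3 x.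
  by rewrite hornerMXaddC hornerC /quarticI /i0; ring.
have JE x : pJ.[x] = quarticJ a0 a1 a2 a3 x.
  by rewrite hornerMXaddC hornerC /quarticJ /j0 /h /semiH; ring.
pose p := pI ^+ 3 - l *: pJ ^+ 2.
have pE x : p.[x] = quarticI a0 a1 a2 a3 x ^+ 3 - l * quarticJ a0 a1 a2 a3 x ^+ 2.
  by rewrite hornerD hornerN hornerZ !horner_exp IE JE.
have dpE x : (p^`()).[x] = 3%:R * a0 * quarticI a0 a1 a2 a3 x ^+ 2
                            - 2%:R * l * h * quarticJ a0 a1 a2 a3 x.
  have linD (u v : K) : (u%:P * 'X + v%:P)^`() = u%:P.
    by rewrite derivD derivC addr0 derivM derivC mul0r add0r derivX mulr1.
  rewrite /p derivB derivZ !deriv_exp !linD !(hornerD, hornerN, hornerZ, hornerMn).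
  by rewrite !hornerM !horner_exp !hornerC IE JE; ring.
have rootE x : p.[x] = 0 ->
    quarticI a0 a1 a2 a3 x != 0 /\
    quarticI a0 a1 a2 a3 x ^+ 3 = l * quarticJ a0 a1 a2 a3 x ^+ 2.
  rewrite pE => /eqP; rewrite subr_eq0 => /eqP px; split=> //.
  apply: contraNneq nz_G => I0; move/esym/eqP: px.
  rewrite I0 expr0n mulf_eq0 (negPf nz_l) expf_eq0 /= => /eqP J0.
  by rewrite (syz x) I0 J0 !mulr0 subrr.
have size_pI : size (pI ^+ 3) = 4%N.
  have : (size (pI ^+ 3)).-1 = 3%N.
    by rewrite size_exp size_MXaddC polyC_eq0 (negPf nz_a0) size_polyC nz_a0.
  by case: (size _) => // n /= ->.
have size_pJ : (size pJ <= 2)%N.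
  by rewrite size_MXaddC; case: ifP => // _; rewrite ltnS size_polyC_leq1.
have size_p : size p = 4%N.
  rewrite /p size_polyDl // size_polyN size_pI.
  rewrite (leq_ltn_trans (size_scale_leq _ _)) //.
  rewrite (leq_ltn_trans (size_poly_exp_leq _ _)) //.
  by move: size_pJ; case: (size _) => [|[|[|//]]].
have sep_p : separable_poly p.
  rewrite unlock; apply: (@Pdiv.ClosedField.root_coprimep K) => x /eqP px; rewrite dpE.
  have [nz_I cusp] := rootE x px.
  apply/eqP => dpx; move/eqP: nz_disc; apply.
  have {}syz := syz x.
  move: nz_I cusp dpx syz; move: (quarticI _ _ _ _ _) (quarticJ _ _ _ _ _) => I J.
  move=> nz_I cusp /eqP; rewrite subr_eq0 => /eqP dpx gE.
  have nz_J : J != 0.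
    by apply: contraNneq nz_I => J0; move/eqP: cusp; rewrite J0 expr0n mulr0 expf_eq0.
  have hI : 3%:R * a0 * J = 2%:R * h * I.
    apply: (mulfI (mulf_neq0 nz_l nz_J)).
    transitivity (3%:R * a0 * I ^+ 2 * I); last by rewrite dpx; ring.
    by transitivity (3%:R * a0 * (l * J ^+ 2)); [ring | rewrite -cusp; ring].
  have lh3 : 8%:R * l * h ^+ 3 = 27%:R * a0 ^+ 3 * J.
    apply: (mulfI (expf_neq0 2 nz_J)).
    transitivity ((2%:R * h * I) ^+ 3); last by rewrite -hI; ring.
    by transitivity (8%:R * h ^+ 3 * (l * J ^+ 2)); [ring | rewrite -cusp; ring].
  apply: (mulfI (_ : 2%:R != 0)); first by rewrite pnatr_eq0.
  rewrite mulr0 gE.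
  transitivity (27%:R * a0 ^+ 2 * (2%:R * h * I) - 54%:R * a0 ^+ 3 * J
                - 8%:R * l * h ^+ 3); first by ring.
  by rewrite -hI lh3; ring.
have [rs p_rs] := closed_field_poly_normal p.
have nz_lc : lead_coef p != 0 by rewrite lead_coef_eq0 -size_poly_eq0 size_p.
exists rs; split.
- by rewrite -separable_prod_XsubC -(eqp_separable (eqp_scale _ nz_lc)) -p_rs.
- by apply: succn_inj; rewrite -size_p p_rs size_scale // size_prod_XsubC.
by move=> x x_rs; apply: rootE; apply/eqP; rewrite -rootE p_rs rootZ // root_prod_XsubC.
Qed.

End Cusp.

(** * Divisibility by I^3 - l J^2 *)

Section Ideal.
Variable K : numClosedFieldType.
Implicit Types (e v w : 'rV[K]_5) (f : {mpoly K[5]}).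

Lemma rmorph_quarticI (S T : comNzRingType) (phi : {rmorphism S -> T}) a0 a1 a2 a3 a4 :
  phi (quarticI a0 a1 a2 a3 a4) =
  quarticI (phi a0) (phi a1) (phi a2) (phi a3) (phi a4).
Proof. by rewrite /quarticI !(rmorph_nat, rmorphD, rmorphN, rmorphM, rmorphXn). Qed.

Lemma rmorph_quarticJ (S T : comNzRingType) (phi : {rmorphism S -> T}) a0 a1 a2 a3 a4 :
  phi (quarticJ a0 a1 a2 a3 a4) =
  quarticJ (phi a0) (phi a1) (phi a2) (phi a3) (phi a4).
Proof. by rewrite /quarticJ !(rmorph_nat, rmorphD, rmorphN, rmorphM, rmorphXn). Qed.

Lemma meval_avar n i (u : 'I_n.+1 -> K) : (avar K n i).@[u] = u (inord i).
Proof. by rewrite avar.unlock mevalXU. Qed.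

Definition polyI : {mpoly K[5]} :=
  quarticI (avar K 4 0) (avar K 4 1) (avar K 4 2) (avar K 4 3) (avar K 4 4).
Definition polyJ : {mpoly K[5]} :=
  quarticJ (avar K 4 0) (avar K 4 1) (avar K 4 2) (avar K 4 3) (avar K 4 4).

Lemma meval_polyI (u : 'I_5 -> K) (c := fun i => u (inord i)) :
  polyI.@[u] = quarticI (c 0%N) (c 1%N) (c 2%N) (c 3%N) (c 4%N).
Proof. by rewrite /polyI rmorph_quarticI /= !meval_avar. Qed.

Lemma meval_polyJ (u : 'I_5 -> K) (c := fun i => u (inord i)) :
  polyJ.@[u] = quarticJ (c 0%N) (c 1%N) (c 2%N) (c 3%N) (c 4%N).
Proof. by rewrite /polyJ rmorph_quarticJ /= !meval_avar. Qed.

Lemma evalv_polyI v : evalv polyI v = invI v.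
Proof. exact: meval_polyI. Qed.

Lemma evalv_polyJ v : evalv polyJ v = invJ v.
Proof. exact: meval_polyJ. Qed.

Lemma avar_homog i : avar K 4 i \is 1.-homog.
Proof. by rewrite avar.unlock dhomogX /= mdeg1. Qed.

Lemma polyI_homog : polyI \is 2.-homog.
Proof.
have h := avar_homog; rewrite /polyI /quarticI !mulr_natl expr2.
by rewrite !(rpredD, rpredN, rpredMn) //; apply: (dhomogM (h _) (h _)).
Qed.

Lemma polyJ_homog : polyJ \is 3.-homog.
Proof.
have h := avar_homog; rewrite /polyJ /quarticJ !mulr_natl !exprS !expr0 !mulr1.
have h2 i j := dhomogM (h i) (h j).
have h3 i j k : avar K 4 i * avar K 4 j * avar K 4 k \is 3.-homog
  := dhomogM (h2 i j) (h k).
by rewrite !mulrA !(rpredD, rpredN, rpredMn) //; apply: h3.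
Qed.

Definition cuspform (l : K) : {mpoly K[5]} := polyI ^+ 3 - l *: polyJ ^+ 2.

Lemma evalv_cuspform l v : evalv (cuspform l) v = invI v ^+ 3 - l * invJ v ^+ 2.
Proof.
rewrite /evalv mevalB mevalZ !rmorphXn /= -/(evalv _ _) -/(evalv polyJ v).
by rewrite evalv_polyI evalv_polyJ.
Qed.

Lemma cuspform_homog l : cuspform l \is 6.-homog.
Proof.
by rewrite rpredB ?rpredZ // ?(dhomogMn 3 polyI_homog) ?(dhomogMn 2 polyJ_homog).
Qed.

Local Notation bvar := (avar K 3).

Lemma muni_avar i : (i < 4)%N -> muni (avar K 4 i) = (bvar i)%:P.
Proof.
move=> i4; rewrite avar.unlock -muni_widen; congr (muni 'X__).
by apply/val_inj; rewrite /= !inordK // (ltn_trans i4).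
Qed.

Lemma muni_avar4 : muni (avar K 4 4) = 'X.
Proof.
rewrite avar.unlock -muni_max; congr (muni 'X__).
by apply/val_inj; rewrite /= inordK.
Qed.

Lemma Poly4 (S : nzRingType) (c0 c1 c2 c3 : S) :
  Poly [:: c0; c1; c2; c3] = c3%:P * 'X^3 + c2%:P * 'X^2 + c1%:P * 'X + c0%:P.
Proof.
rewrite /= !cons_poly_def mul0r add0r !mulrDl -!mulrA.
by rewrite -expr2 -exprS.
Qed.

Lemma quarticI_linear (S : comNzRingType) (a0 a1 a2 a3 : S) :
  quarticI a0%:P a1%:P a2%:P a3%:P 'X =
  a0%:P * 'X + (- (4%:R * (a1 * a3)) + 3%:R * a2 ^+ 2)%:P.
Proof.
by rewrite /quarticI !(rmorph_nat, rmorphD, rmorphN, rmorphM, rmorphXn) /=; ring.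
Qed.

Lemma quarticJ_linear (S : comNzRingType) (a0 a1 a2 a3 : S) :
  quarticJ a0%:P a1%:P a2%:P a3%:P 'X =
  (semiH a0 a1 a2)%:P * 'X
    + (2%:R * (a1 * a2 * a3) - a2 ^+ 3 - a0 * a3 ^+ 2)%:P.
Proof.
rewrite /quarticJ /semiH.
by rewrite !(rmorph_nat, rmorphD, rmorphN, rmorphM, rmorphXn) /=; ring.
Qed.

Lemma cusp_expand (S : comNzRingType) (l a b h d : S) :
  (a%:P * 'X + b%:P) ^+ 3 - l%:P * (h%:P * 'X + d%:P) ^+ 2 =
  Poly [:: b ^+ 3 - l * d ^+ 2; 3%:R * a * b ^+ 2 - 2%:R * l * h * d;
           3%:R * a ^+ 2 * b - l * h ^+ 2; a ^+ 3].
Proof.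
rewrite Poly4 !(rmorph_nat, rmorphD, rmorphN, rmorphM, rmorphXn) /=; ring.
Qed.

Lemma cusp_lead_coef (S : comNzRingType) (l a b h d : S)
    (p := (a%:P * 'X + b%:P) ^+ 3 - l%:P * (h%:P * 'X + d%:P) ^+ 2) :
  a ^+ 3 != 0 -> size p = 4%N /\ lead_coef p = a ^+ 3.
Proof. by move=> nz_a3; rewrite /p cusp_expand lead_coefE (@PolyK _ 0). Qed.

Lemma muni_cuspform l :
  size (muni (cuspform l)) = 4%N /\ lead_coef (muni (cuspform l)) = bvar 0 ^+ 3.
Proof.
have nz_a3 : bvar 0 ^+ 3 != 0.
  rewrite expf_eq0 /=; apply/eqP => /(congr1 (meval (fun=> 1)))/eqP.
  by rewrite meval_avar meval0 oner_eq0.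
rewrite /cuspform muniB muniZ -mul_polyC !rmorphXn /= rmorph_quarticI rmorph_quarticJ.
rewrite /= muni_avar4 (@muni_avar 0) // (@muni_avar 1) // (@muni_avar 2) //.
rewrite (@muni_avar 3) // quarticI_linear quarticJ_linear.
exact: cusp_lead_coef.
Qed.

(** The general fibre of the projection forgetting a4 meets the zero locus of
    I^3 - l J^2 in three points outside I = 0. *)
Lemma cuspform_dvd l f : l != 0 ->
    (forall v, invI v != 0 -> invI v ^+ 3 = l * invJ v ^+ 2 -> evalv f v = 0) ->
  exists q, f = q * cuspform l.
Proof.
move=> nz_l f0.
have [size_c lead_c] := muni_cuspform l.
pose G := semiG (bvar 0) (bvar 1) (bvar 2) (bvar 3).
pose H := semiH (bvar 0) (bvar 1) (bvar 2).
pose D := bvar 0 * G * (27%:R * G - (4%:R * l) *: H ^+ 3).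
have DE b (c := fun i => b (inord i)) :
    D.@[b] = c 0%N * semiG (c 0%N) (c 1%N) (c 2%N) (c 3%N) *
      (27%:R * semiG (c 0%N) (c 1%N) (c 2%N) (c 3%N)
        - 4%:R * l * semiH (c 0%N) (c 1%N) (c 2%N) ^+ 3).
  rewrite /D /G /H /semiG /semiH.
  by rewrite !(rmorph_nat, mevalD, mevalN, mevalM, mevalZ, rmorphXn) /= !meval_avar.
(* At (a0, a1, a2, a3) = (1, 0, 0, 1), H = 0 and T = 1. *)
have nz_D : D != 0.
  pose b (i : 'I_4) : K := nth 0 [:: 1; 0; 0; 1] i.
  apply/eqP => /(congr1 (meval b)); rewrite DE meval0 /b !inordK //= /semiG /semiH.
  rewrite !(mulr0, mul0r, subr0, mul1r, mulr1, expr0n, expr1n, addr0) /=.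
  by move/eqP; rewrite pnatr_eq0.
have [|k [q]] := @mpoly_pseudo_dvd K 4 (cuspform l) f D 3 _ size_c lead_c nz_D.
  move=> b; rewrite DE !mulf_eq0 !negb_or => /andP[/andP[nz_b0 nz_G] nz_disc].
  have [rs [uniq_rs size_rs rsP]] := cusp_fibre nz_l nz_b0 nz_G nz_disc.
  exists rs; split=> // x /rsP[nz_I cusp].
  pose v : 'rV[K]_5 := \row_i extend b x i.
  have evE p : p.@[extend b x] = evalv p v by apply: meval_eq => i; rewrite mxE.
  have vb i : (i < 4)%N -> qcoef v i = b (inord i).
    move=> i4; rewrite /qcoef mxE /extend.
    have -> : inord i = lift ord_max (inord i : 'I_4) :> 'I_5.
      by apply/val_inj; rewrite [RHS]lift_max /= !inordK // (ltn_trans i4).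
    by rewrite liftK.
  have vx : qcoef v 4 = x.
    rewrite /qcoef mxE /extend (_ : inord 4 = ord_max) ?unlift_none //.
    by apply/val_inj; rewrite /= inordK.
  rewrite -(vb 0%N) // -(vb 1%N) // -(vb 2%N) // -(vb 3%N) // -vx in nz_I cusp.
  by rewrite !evE evalv_cuspform cusp subrr f0.
rewrite rmorphXn /= avar.unlock mwidenX mnmwiden1 -exprM => fE.
(* At (0, 1, 0, 0, 1), on the hyperplane a0 = 0, I = 0 and J = -1. *)
pose v : 'I_5 -> K := fun i => ((i == inord 1) || (i == inord 4))%:R.
apply: (@dvd_cancel_var K 5 _ (3 * k) _ _ _ v _ _ fE).
  by rewrite /v -!val_eqE /= !inordK.
have -> : (cuspform l).@[v] = - l; last by rewrite oppr_eq0.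
  rewrite /cuspform mevalB mevalZ !rmorphXn /= meval_polyI meval_polyJ.
  by rewrite /v -!val_eqE /= !inordK //= /quarticI /quarticJ; ring.
Qed.

End Ideal.

(** * Orbits, their closures and their ideals *)

Section Orbit.
Variable K : numClosedFieldType.
Implicit Types (e v w : 'rV[K]_5) (f : {mpoly K[5]}) (E : hpoint K 4).

(** Over an infinite field, an identity between forms can be tested on values,
    where substitution is composition. *)
Lemma form_of_linsubst c (M : 'M[K]_2) v w :
  form_of w = c *: linsubst M (form_of v) <->
  forall x y, qval w x y =
    c * qval v (M ix1 ix1 * x + M ix1 ix2 * y) (M ix2 ix1 * x + M ix2 ix2 * y).
Proof.
have evM x y : (linsubst M (form_of v)).@[point2 x y] =
    qval v (M ix1 ix1 * x + M ix1 ix2 * y) (M ix2 ix1 * x + M ix2 ix2 * y).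
  rewrite comp_mpoly_meval -meval_form_of; apply: meval_eq => k.
  rewrite tnth_mktuple !big_ord_recr big_ord0 /= add0r mevalD !mevalZ !mevalXU.
  have -> : widen_ord (leqnSn 1) ord_max = ix1 by apply/val_inj.
  by case: k => [[|[|//]] ?]; congr (M _ _ * _ + M _ _ * _); apply/val_inj.
split=> [wE x y|wE]; first by rewrite -meval_form_of wE mevalZ evM.
apply/eqP; rewrite -subr_eq0; apply/eqP/mpoly_eq0_meval => u.
have uE k : u k = point2 (u ix1) (u ix2) k.
  by case: k => [[|[|//]] ?]; congr u; apply/val_inj.
rewrite (meval_eq _ uE) mevalB mevalZ evM meval_form_of wE.
by apply/eqP; rewrite subr_eq0.
Qed.

Lemma det2 (M : 'M[K]_2) : \det M = M ix1 ix1 * M ix2 ix2 - M ix1 ix2 * M ix2 ix1.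
Proof.
rewrite (expand_det_row _ ix1) !big_ord_recr big_ord0 /= add0r /cofactor !det_mx11 !mxE.
have -> : widen_ord (leqnSn 1) ord_max = ix1 by apply/val_inj.
rewrite -/ix2 /= expr0 expr1 mul1r mulN1r mulrN.
by congr (_ * M _ _ - _ * M _ _); apply/val_inj.
Qed.

Lemma sl2_orbitP E (P : hpoint K 4) :
  sl2_orbit E P <-> exists2 k, k != 0 & sl2_equiv k (val E) (val P).
Proof.
split=> [[M [c [detM nz_c /form_of_linsubst PE]]]|[k nz_k]].
  exists c => //; apply/sl2_equivP; rewrite det2 in detM.
  by exists (M ix1 ix1), (M ix1 ix2), (M ix2 ix1), (M ix2 ix2).
move=> /sl2_equivP[a [b [c [d [det1 PE]]]]].
pose M : 'M[K]_2 := \matrix_(i, j)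
  if i == ix1 then (if j == ix1 then a else b) else (if j == ix1 then c else d).
exists M, k; split=> //; first by rewrite det2 !mxE.
by apply/form_of_linsubst => x y; rewrite !mxE.
Qed.

Lemma evalv_g2 v : evalv (g2 K) v = 2%:R * invI v.
Proof. by rewrite g2_quarticI /evalv mevalM rmorph_nat -evalv_polyI. Qed.

Lemma evalv_g3 v : evalv (g3 K) v = 6%:R * invJ v.
Proof. by rewrite g3_quarticJ /evalv mevalM rmorph_nat -evalv_polyJ. Qed.

Lemma sl2_invariant_of_inv (g : {mpoly K[5]}) :
    (forall v w, invI w = invI v -> invJ w = invJ v -> evalv g w = evalv g v) ->
  @sl2_invariant K 4 g.
Proof.
move=> gE M v w detM wE; rewrite det2 in detM.
have v_w : sl2_equiv 1 v w.
  apply/sl2_equivP; exists (M ix1 ix1), (M ix1 ix2), (M ix2 ix1), (M ix2 ix2).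
  by split=> //; apply/form_of_linsubst; rewrite scale1r.
by have [] := sl2_equiv_inv v_w; rewrite !expr1n !mul1r; apply: gE.
Qed.

Definition generic_quartics E : Prop :=
  [/\ invI (val E) != 0, invJ (val E) != 0 & disc (val E) != 0].

Definition genericity : {mpoly K[5]} :=
  polyI K * polyJ K * cuspform (27%:R : K).

Lemma evalv_genericity v : evalv genericity v = invI v * invJ v * disc v.
Proof.
rewrite /evalv /genericity !mevalM -/(evalv _ _) -/(evalv (polyJ K) v).
by rewrite -/(evalv (cuspform _) v) evalv_polyI evalv_polyJ evalv_cuspform.
Qed.

Lemma genericityP E : generic_quartics E <-> evalv genericity (val E) != 0.
Proof.
rewrite evalv_genericity !mulf_eq0 !negb_or.
by split=> [[-> -> ->]|/andP[/andP[]]].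
Qed.

(** At (0, 1, 0, -1, -1), I = 4 and J = 1. *)
Lemma genericity_neq0 : genericity != 0.
Proof.
apply/eqP => /(congr1 (fun p => evalv p (quartic 0 1 0 (-1) (-1)))).
rewrite evalv_genericity /disc /invI /invJ !qcoef_quartic /evalv meval0.
rewrite /quarticI /quarticJ => /eqP.
have -> : (0 : K) * -1 - 4%:R * (1 * -1) + 3%:R * 0 ^+ 2 = 4%:R by ring.
have -> : (0 : K) * 0 * -1 + 2%:R * (1 * 0 * -1) - 0 ^+ 3 - 0 * (-1) ^+ 2
          - 1 ^+ 2 * -1 = 1 by ring.
have -> : 4%:R * 1 * (4%:R ^+ 3 - 27%:R * 1 ^+ 2) = 148%:R :> K by ring.
by rewrite pnatr_eq0.
Qed.

Lemma invI0 : invI (0 : 'rV[K]_5) = 0.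
Proof. by rewrite -(scale0r 0) invIZ expr0n mul0r. Qed.

Lemma invI_neq0 v : invI v != 0 -> v != 0.
Proof. by apply: contraNneq => ->; rewrite invI0. Qed.

Lemma zariski_open_generic : zariski_open generic_quartics.
Proof.
exists (eq genericity); split=> [_ <-|P].
  exists 11%N.
  exact: (dhomogM (dhomogM (polyI_homog K) (polyJ_homog K)) (cuspform_homog _)).
split=> [nP _ <-|P0 /genericityP]; last by rewrite P0 // eqxx.
by apply/eqP/negPn/negP => /genericityP.
Qed.

(** If f vanishes on the generic quartics, its product with their equation
    vanishes everywhere. *)
Lemma zariski_dense_generic : zariski_dense generic_quartics.
Proof.
move=> P Y [G [_ YE]] sub_Y; apply/YE => f Gf.
suffices -> : f = 0 by rewrite /evalv meval0.
apply: (mulfI genericity_neq0); rewrite mulr0; apply: mpoly_eq0_meval => u.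
pose v : 'rV[K]_5 := \row_i u i.
have uE p : p.@[u] = evalv p v by apply: meval_eq => i; rewrite mxE.
rewrite mevalM !uE; have [->|nz_g] := eqVneq (evalv genericity v) 0.
  by rewrite mul0r.
have nz_v : v != 0.
  apply: invI_neq0; move: nz_g; rewrite evalv_genericity.
  by rewrite !mulf_eq0 !negb_or => /andP[/andP[]].
pose Q : hpoint K 4 := exist _ v nz_v.
have /YE/(_ f Gf) -> : Y Q by apply/sub_Y/genericityP.
by rewrite mulr0.
Qed.

Definition cusp_ratio v : K := invI v ^+ 3 / invJ v ^+ 2.

Section GenericPoint.
Variables (E : hpoint K 4) (genE : generic_quartics E).
Let c := cuspform (cusp_ratio (val E)).

Let nz_ratio : cusp_ratio (val E) != 0.
Proof. by case: genE => nzI nzJ _; rewrite mulf_neq0 ?invr_eq0 ?expf_neq0. Qed.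

Lemma orbit_cuspform P : sl2_orbit E P -> evalv c (val P) = 0.
Proof.
case/sl2_orbitP => k nz_k /sl2_equiv_inv[PI PJ]; case: genE => nzI nzJ _.
by rewrite evalv_cuspform PI PJ /cusp_ratio; field.
Qed.

(** Off I = 0, the zero locus of c lies in the orbit, so that only the values of
    f on the orbit are involved in [cuspform_dvd]. *)
Lemma vanishing_on_orbit f :
  (forall P, sl2_orbit E P -> evalv f (val P) = 0) -> exists q, f = q * c.
Proof.
move=> f0; apply: cuspform_dvd => // v nz_I cusp; case: genE => nzI nzJ nz_disc.
have [] := sl2_equiv_of_cusp nzI nzJ nz_disc nz_I.
  by rewrite cusp /cusp_ratio; field.
move=> k nz_k E_v; pose P : hpoint K 4 := exist _ v (invI_neq0 nz_I).
by apply: (f0 P); apply/sl2_orbitP; exists k.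
Qed.

(** At (0, 1, 0, 0, 1), I = 0 and J = -1. *)
Lemma cuspform_neq0 : c != 0.
Proof.
apply/eqP => c0; have := evalv_cuspform (cusp_ratio (val E)) (quartic 0 1 0 0 1).
rewrite -/c c0 /evalv meval0 /invI /invJ !qcoef_quartic /quarticI /quarticJ => /eqP.
have -> : ((0 : K) * 1 - 4%:R * (1 * 0) + 3%:R * 0 ^+ 2) ^+ 3 - cusp_ratio (val E) *
  (0 * 0 * 1 + 2%:R * (1 * 0 * 0) - 0 ^+ 3 - 0 * 0 ^+ 2 - 1 ^+ 2 * 1) ^+ 2 =
  - cusp_ratio (val E) by ring.
by rewrite eq_sym oppr_eq0 (negPf nz_ratio).
Qed.

Lemma Omega_cuspform P : Omega E P <-> evalv c (val P) = 0.
Proof.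
split=> [OP|cP].
  have : (zero_locus (eq c)) P; last exact.
  apply: OP => [|Q orbQ _ <-]; last exact: orbit_cuspform.
  by exists (eq c); split=> // _ <-; exists 6%N; apply: cuspform_homog.
move=> Y [G [_ YE]] sub_Y; apply/YE => f Gf.
have [Q orbQ|q ->] := @vanishing_on_orbit f.
  by have /YE := sub_Y Q orbQ; apply.
by rewrite /evalv mevalM -/(evalv c _) cP mulr0.
Qed.

(** If c = h^2 q, then h q vanishes on the orbit, so h q = s c = (s h) (h q) and
    h is a unit. *)
Lemma squarefree_cuspform : squarefree c.
Proof.
split=> [|h q cE]; first exact: cuspform_neq0.
have [|s hqE] := @vanishing_on_orbit (h * q).
  move=> P /orbit_cuspform/eqP; rewrite cE expr2 -mulrA {1}/evalv mevalM mulf_eq0.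
  case/orP=> /eqP hP; last exact: hP.
  by rewrite /evalv mevalM hP mul0r.
have nz_hq : h * q != 0.
  by have := cuspform_neq0; rewrite cE expr2 -mulrA mulf_eq0 negb_or => /andP[].
have : s * h = 1.
  apply: (mulIf nz_hq); rewrite mul1r [RHS]hqE cE; ring.
move/mpoly_intro_unit => /andP[/eqP hC _].
by exists (h@_0%MM).
Qed.

Lemma hypersurface_Omega : hypersurface_of_degree 6 (Omega E).
Proof.
exists c; split; [exact: cuspform_homog | exact: squarefree_cuspform |].
by move=> P; rewrite Omega_cuspform; split=> [cP _ <-|]; last exact.
Qed.

(** With g2 = 2 I and g3 = 6 J, both terms acquire the factor 6^2 2^3 = 288. *)
Lemma theta_cuspform :
  theta E (g3 K) ^+ 2 *: g2 K ^+ 3 - theta E (g2 K) ^+ 3 *: g3 K ^+ 2 =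
  (288%:R * invJ (val E) ^+ 2) *: c.
Proof.
case: genE => nzI nzJ _.
transitivity ((6%:R * invJ (val E)) ^+ 2 *: (2%:R * polyI K) ^+ 3
              - (2%:R * invI (val E)) ^+ 3 *: (6%:R * polyJ K) ^+ 2).
  congr (_ ^+ 2 *: _ ^+ 3 - _ ^+ 3 *: _ ^+ 2).
  - exact: evalv_g3.
  - exact: g2_quarticI.
  - exact: evalv_g2.
  exact: g3_quarticJ.
rewrite /c /cuspform scalerBr scalerA.
have -> : 288%:R * invJ (val E) ^+ 2 * cusp_ratio (val E) = 288%:R * invI (val E) ^+ 3.
  by rewrite /cusp_ratio; field.
move: (polyI K) (polyJ K) (invI _) (invJ _) => p q i j; rewrite -!mul_mpolyC.
rewrite !mpolyCM !mpolyC_nat; ring.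
Qed.

Lemma I_cuspform p : I_ E p <->
  ideal_generated_by
    (eq (theta E (g3 K) ^+ 2 *: g2 K ^+ 3 - theta E (g2 K) ^+ 3 *: g3 K ^+ 2)) p.
Proof.
rewrite theta_cuspform; set k := _ * _.
have nz_k : k != 0.
  by case: genE => _ nzJ _; rewrite mulf_neq0 ?expf_neq0 ?pnatr_eq0.
split=> [[s [sG ->]]|[s [sG ->]]].
  elim: s sG => [|[a f] s IHs] sG.
    by exists [::]; rewrite !big_nil.
  have [|t [tG tE]] := IHs _; first by move=> x xs; apply: sG; rewrite inE xs orbT.
  have [_ f0] := sG (a, f) (mem_head _ _).
  have [|q fE] := @vanishing_on_orbit f.
    by move=> P orbP; apply: f0 => Y _; apply.
  exists ((a * (k^-1 *: q), k *: c) :: t); split=> [x|].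
    by rewrite inE => /predU1P[-> //|]; apply: tG.
  rewrite !big_cons tE /= fE; congr (_ + _).
  by rewrite -scalerAr -scalerAr -scalerAl scalerA mulfV // scale1r mulrA.
exists s; split=> // x /sG <-; split.
  by exists 6%N; rewrite rpredZ ?cuspform_homog.
by move=> P /Omega_cuspform cP; rewrite /evalv mevalZ -/(evalv c _) cP mulr0.
Qed.

End GenericPoint.
End Orbit.

Theorem mainTheorem3 (R : realType) :
  let C : fieldType := R[i] in
  [/\ g2 C \is 2.-homog, sl2_invariant (g2 C),
      g3 C \is 3.-homog & sl2_invariant (g3 C)] /\
  exists U : hpoint C 4 -> Prop,
    [/\ zariski_open U, zariski_dense U &
      forall E : hpoint C 4, U E ->
        hypersurface_of_degree 6 (Omega E) /\
        (forall p : {mpoly C[5]},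
           I_ E p <->
           ideal_generated_by
             (eq (theta E (g3 C) ^+ 2 *: g2 C ^+ 3
                  - theta E (g2 C) ^+ 3 *: g3 C ^+ 2)) p)].
Proof.
move=> C; pose K : numClosedFieldType := R[i].
split; last first.
  exists (@generic_quartics K); split.
  - exact: zariski_open_generic.
  - exact: zariski_dense_generic.
  move=> E genE; split; first exact: (hypersurface_Omega genE).
  exact: (I_cuspform genE).
split.
- rewrite (g2_quarticI K) mulr_natl; exact: (rpredMn _ (polyI_homog K)).
- by apply: (@sl2_invariant_of_inv K) => v w Iw _; rewrite !evalv_g2 Iw.
- rewrite (g3_quarticJ K) mulr_natl; exact: (rpredMn _ (polyJ_homog K)).
by apply: (@sl2_invariant_of_inv K) => v w _ Jw; rewrite !evalv_g3 Jw.
Qed.
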